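(* Let $\lambda$ be either RP or CP, and let $k>m>0$ be integers. Let $\phi:Z\to Y$ be a map of metric spaces (as sets), $X\subset Z$ a subspace, and $X'\subset Z$ another subspace with $d_{GH}(X,X')<\delta$. Suppose also that $d_{GH}(\phi(X'),Y)<\delta$. Finally, let $\Gamma$ be a collection of subsets of $Z$ of cardinality $k$ through $k-m-1$ satisfying the covering and closure properties for $X'$: (Covering) for every pair of points $\{x_1,x_2\}$ in $X'$ there is a subset $S\in\Gamma$ such that $|S|=k$ and $\{x_1,x_2\}\subset S$; (Closure) if $S\in\Gamma$ has $|S|=k$, and $S'\subset S$ has $|S'|\ge k-m-1$, then $S'\in\Gamma$; and such that $d_B(\lambda^m(S),\lambda^m(\phi(S)))\le\epsilon$ for all $S\in\Gamma$. If $\lambda$ is RP, then $d_{GH}(X,Y)\le 112k^2\epsilon+2\delta$, and if $\lambda$ is CP, then $d_{GH}(X,Y)\le 224\,S(k,m)\,k^{m+1}\epsilon+2\delta$, where $$S(k,m)=\binom{k}{2}+\binom{k}{3}+\cdots+\binom{k}{m+1}.$$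
   Context: $d_{GH}$ denotes the Gromov--Hausdorff distance. For a metric space $(W,d)$, let $K(W)$ be the simplicial complex of all nonempty finite subsets of $W$. The Rips filtration function is $f(\sigma)=\max_{x,y\in\sigma}d(x,y)$. For the Čech filtration, $W$ is given as a subspace of an ambient metric space $E$ (e.g. $E=\mathbb{R}^d$ for a Euclidean point cloud) and $f(\sigma)=2\inf_{c\in E}\max_{x\in\sigma}d(c,x)$, where $E$ is such that an edge $\{x,y\}$ has $f(\{x,y\})=d(x,y)$. In either case $f(\sigma)$ depends only on $\sigma$. For a finite $S\subseteq W$, $K^m(S)$ is the $m$-skeleton of the complex of simplices contained in $S$, filtered by the sublevel sets $\{\sigma: f(\sigma)\le r\}$. $\lambda^m(S)$ is the collection of persistence diagrams, in every homological degree (field coefficients), of the filtered complex $K^m(S)$, using the Rips filtration if $\lambda=$ RP (Rips persistence) and the Čech filtration if $\lambda=$ CP (Čech persistence). $d_B$ is the bottleneck distance (with $\ell^\infty$ ground metric, points may be matched to the diagonal), maximized over all homological degrees. *)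

(* Defs.v *)
From HB Require Import structures.
From mathcomp Require Import all_boot all_order all_algebra finmap.
From mathcomp Require Import all_classical all_reals all_analysis.
Set Implicit Arguments.
Unset Strict Implicit.
Unset Printing Implicit Defensive.
Import Order.TTheory GRing.Theory Num.Theory.
Local Open Scope classical_set_scope.
Local Open Scope ring_scope.

Section GromovHausdorff.
Context {R : realType}.

(* The infimum of the empty set is +oo, so the distance between an empty and a
   nonempty set is +oo, and that between two empty sets is 0. *)
Definition hausdorff_dist (M : metricType R) (A B : set M) : \bar R :=
  ereal_inf [set r%:E | r in [set r : R | [/\ 0 <= r,
    forall a, A a -> exists2 b, B b & mdist a b <= r &
    forall b, B b -> exists2 a, A a & mdist a b <= r]]].

Definition isometric_on (T M : metricType R) (A : set T) (f : T -> M) : Prop :=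
  forall x y, A x -> A y -> mdist (f x) (f y) = mdist x y.

(* Gromov--Hausdorff distance between the subspaces A of T and B of U: infimum
   of the Hausdorff distances over all isometric embeddings of A and B into a
   common metric space; f and g are only constrained on A and B. *)
Definition dGH (T U : metricType R) (A : set T) (B : set U) : \bar R :=
  ereal_inf [set d | exists (M : metricType R) (f : T -> M) (g : U -> M),
    [/\ isometric_on A f, isometric_on B g & d = hausdorff_dist (f @` A) (g @` B)]].

End GromovHausdorff.

Inductive pers_kind := RP | CP.

Section Filtrations.
Context {R : realType}.

(* All distances are nonnegative, so starting the maxima at 0 is harmless. *)
Definition rips (W : metricType R) (s : {fset W}) : R :=
  \big[Num.max/0]_(x <- s) \big[Num.max/0]_(y <- s) mdist x y.

Definition cech (W E : metricType R) (incl : W -> E) (s : {fset W}) : R :=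
  2 * inf [set \big[Num.max/0]_(x <- s) mdist c (incl x) | c in [set: E]].

(* incl exhibits W as a subspace of E, and edges have Cech value equal to their
   length. *)
Definition cech_ambient (W E : metricType R) (incl : W -> E) : Prop :=
  isometric_on [set: W] incl /\
  forall x y : W, cech incl [fset x; y]%fset = mdist x y.

Definition filtration (lam : pers_kind) (W E : metricType R) (incl : W -> E) :
    {fset W} -> R :=
  match lam with RP => @rips W | CP => cech incl end.

End Filtrations.

Section Chains.
Context (F : fieldType) (T : finType).

(* Simplices are sets of vertices, oriented by the enumeration order of T;
   chains of all dimensions live in one space. *)
Definition chain := {ffun {set T} -> F^o}.

(* (d c)(tau) is the sum over the simplices x |: tau having tau as a facet, with
   sign given by the position of x in x |: tau. There is no coefficient on the
   empty simplex: homology is unreduced. *)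
Definition bnd_fun (c : chain) : chain :=
  [ffun tau : {set T} => if tau == finset.set0 then 0 else
    \sum_(x | x \notin tau)
      (-1) ^+ #|[set y in tau | (enum_rank y < enum_rank x)%N]|%SET
      * c (x |: tau)%SET].

Lemma bnd_fun_linear : linear bnd_fun.
Proof.
move=> a u v; apply/ffunP => tau; rewrite !ffunE.
case: ifP => _; first by rewrite scaler0 addr0.
rewrite scaler_sumr -big_split /=; apply: eq_bigr => x _.
by rewrite !ffunE mulrDr; congr (_ + _); rewrite /GRing.scale /= mulrCA.
Qed.

HB.instance Definition _ :=
  GRing.isLinear.Build F chain chain *:%R bnd_fun bnd_fun_linear.

Definition bnd : 'End(chain) := linfun bnd_fun.

Definition simplex_chain (s : {set T}) : chain := [ffun t => (t == s)%:R].

Definition chains (p : nat) (K : {set {set T}}) : {vspace chain} :=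
  <<[seq simplex_chain s | s : {set T} <- enum K & #|s| == p.+1]>>%VS.

Definition cycles (p : nat) (K : {set {set T}}) : {vspace chain} :=
  (chains p K :&: lker bnd)%VS.

Definition boundaries (p : nat) (K : {set {set T}}) : {vspace chain} :=
  (bnd @: chains p.+1 K)%VS.

(* For subcomplexes K of L, the rank of H_p(K) -> H_p(L), whose image is
   Z_p(K) / (Z_p(K) :&: B_p(L)). *)
Definition pers_betti (p : nat) (K L : {set {set T}}) : nat :=
  (\dim (cycles p K) - \dim (cycles p K :&: boundaries p L))%N.

End Chains.

(* A persistence diagram is a finite multiset of (birth, death) points, given as
   a sequence up to permutation; essential classes have death +oo. *)
Definition diagram (R : realType) := seq (R * \bar R).

Section Persistence.
Context {R : realType} (F : fieldType) (W : choiceType).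
Context (f : {fset W} -> R) (m : nat) (S : {fset W}).

Definition skeleton : {set {set S}} := [set s : {set S} | (0 < #|s| <= m.+1)%N]%SET.

Definition fvalue (s : {set S}) : R := f [fset fsval x | x in s]%fset.

Definition sublevel (r : R) : {set {set S}} :=
  [set s in skeleton | fvalue s <= r]%SET.

(* The distinct filtration values, in increasing order. *)
Definition crit : seq R := sort <=%R (undup [seq fvalue s | s <- enum skeleton]).

(* The stages of the filtration are numbered from 1, stage 0 being empty. *)
Definition stage (i : nat) : {set {set S}} :=
  if i is j.+1 then sublevel crit`_j else finset.set0.

Definition pbetti (p i j : nat) : nat := pers_betti F p (stage i) (stage j).

(* Number of degree p classes born at stage i and dying at stage j, where
   0 < i < j; the usual alternating sum of persistent Betti numbers, which is
   nonnegative, arranged so that the subtraction does not truncate. *)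
Definition mult (p i j : nat) : nat :=
  ((pbetti p i j.-1 + pbetti p i.-1 j) - (pbetti p i j + pbetti p i.-1 j.-1))%N.

Definition mult_oo (p i : nat) : nat :=
  (pbetti p i (size crit) - pbetti p i.-1 (size crit))%N.

Definition dgm (p : nat) : diagram R :=
  flatten [seq nseq (mult p i j) (crit`_i.-1, (crit`_j.-1)%:E)
          | i <- iota 1 (size crit), j <- iota i.+1 (size crit - i)]
  ++ flatten [seq nseq (mult_oo p i) (crit`_i.-1, +oo%E)
             | i <- iota 1 (size crit)].

End Persistence.

Definition persistence (R : realType) (F : fieldType) (lam : pers_kind)
    (W E : metricType R) (incl : W -> E) (m : nat) (S : {fset W}) :
    nat -> diagram R :=
  dgm F (filtration lam incl) m S.

Section Bottleneck.
Context {R : realType}.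
Implicit Types (D : diagram R) (u v : R * \bar R).

(* The distance between two infinite deaths is 0 (recall +oo - +oo = -oo). *)
Definition death_dist (x y : \bar R) : \bar R :=
  if x == y then 0%E else `|x - y|%E.

Definition pt_dist u v : \bar R :=
  Order.max (`|u.1 - v.1|%:E)%E (death_dist u.2 v.2).

(* l^oo distance from u to the diagonal. *)
Definition diag_dist u : \bar R := ((u.2 - u.1%:E) * (2^-1)%:E)%E.

(* M lists the matched pairs; U1 and U2 the points matched to the diagonal. *)
Definition matching D1 D2 (e : R) : Prop :=
  exists (M : seq ((R * \bar R) * (R * \bar R))) (U1 U2 : diagram R),
    [/\ perm_eq D1 (unzip1 M ++ U1), perm_eq D2 (unzip2 M ++ U2),
        forall uv, uv \in M -> (pt_dist uv.1 uv.2 <= e%:E)%E &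
        forall u, u \in U1 ++ U2 -> (diag_dist u <= e%:E)%E].

Definition bottleneck D1 D2 : \bar R :=
  ereal_inf [set e%:E | e in [set e : R | 0 <= e /\ matching D1 D2 e]].

Definition dB (L1 L2 : nat -> diagram R) : \bar R :=
  ereal_sup [set bottleneck (L1 p) (L2 p) | p in [set: nat]].

End Bottleneck.

Definition Skm (k m : nat) : nat := (\sum_(2 <= i < m.+2) 'C(k, i))%N.

(* Main.v *)
Require Import Defs.
From HB Require Import structures.
From mathcomp Require Import all_boot all_order all_algebra finmap.
From mathcomp Require Import all_classical all_reals all_analysis.
From mathcomp Require Import zify ring lra.
Import Order.TTheory GRing.Theory Num.Theory.
Local Open Scope classical_set_scope.
Local Open Scope ring_scope.

(** Fix S in Gamma with |S| = k and e > eps. If no filtration value of S or of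
phi(S) lies in (r - e, r + e], then an e-matching pairs exactly the bars alive
at r, so S' and phi(S') have the same Betti numbers, hence the same Euler
characteristic, at level r for every S' in S missing at most m + 1 points.
These Euler characteristics are signed counts of the simplices of value at most
r, so Moebius inversion over S' gives f(s) <= r iff f(phi(s)) <= r for every
simplex s of S, provided phi is injective on S or k = m + 1; comparing S with
S minus a point at a level beyond all values excludes the other cases. By
pigeonhole, two reals further apart than about 2 N e have such a level r between
them, N being the number of filtration values, so phi distorts distances on X'
by O(N e). A correspondence between X and Y is then read off from the two
Gromov--Hausdorff bounds. *)

(** * Homology of subcomplexes *)

Section Homology.
Context (F : fieldType) (T : finType).
Implicit Types (K L : {set {set T}}) (c : chain F T).

Lemma bndE c (tau : {set T}) : bnd F T c tau = if tau == finset.set0 then 0 else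
    \sum_(x | x \notin tau)
      (-1) ^+ #|[set y in tau | (enum_rank y < enum_rank x)%N]|%SET
      * c (x |: tau)%SET.
Proof. by rewrite /bnd lfunE /= ffunE. Qed.

Let rk (tau : {set T}) (x : T) := #|[set y in tau | (enum_rank y < enum_rank x)%N]|%SET.

Lemma rank_insert (tau : {set T}) x y : x \notin tau ->
  rk (x |: tau)%SET y = ((enum_rank x < enum_rank y) + rk tau y)%N.
Proof.
move=> xt; rewrite /rk; case xy: (enum_rank x < enum_rank y)%N.
  rewrite (_ : [set z in _ | _]%SET =
     (x |: [set z in tau | (enum_rank z < enum_rank y)%N])%SET).
    by rewrite cardsU1 !inE (negbTE xt).
  apply/finset.setP => z; rewrite !inE.
  by case: eqP => [->|_] //=; rewrite xy.
rewrite add0n; apply: eq_card => z; rewrite !inE.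
by case: eqP => [->|_] //=; rewrite xy andbF.
Qed.

(* Removing x then y and y then x contribute with opposite signs; the sum is
   split along the vertex order since the characteristic may be 2. *)
Lemma bnd_bnd c : bnd F T (bnd F T c) = 0.
Proof.
apply/ffunP => tau; rewrite bndE ffunE; case: eqP => // /eqP tau0.
pose G x y := (-1) ^+ rk tau x * ((-1) ^+ rk (x |: tau)%SET y *
   c (y |: (x |: tau))%SET) : F.
transitivity (\sum_(x | x \notin tau) \sum_(y | (y \notin tau) && (y != x)) G x y).
  apply: eq_bigr => x xt; rewrite bndE.
  rewrite (negbTE (_ : (x |: tau)%SET != finset.set0)); last first.
    by apply/set0Pn; exists x; rewrite !inE eqxx.
  rewrite mulr_sumr; apply: eq_bigl => y.
  by rewrite !inE negb_or andbC.
pose lt (x y : T) := (enum_rank x < enum_rank y)%N.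
have split2 : \sum_(x | x \notin tau) \sum_(y | (y \notin tau) && (y != x)) G x y =
   \sum_(x | x \notin tau) \sum_(y | (y \notin tau) && lt x y) G x y +
   \sum_(x | x \notin tau) \sum_(y | (y \notin tau) && lt y x) G x y.
  rewrite -big_split /=; apply: eq_bigr => x _.
  rewrite (bigID (lt x)) /=; congr (_ + _); apply: eq_bigl => y; rewrite /lt.
    rewrite -andbA; congr (_ && _).
    by case: eqP => [->|//]; rewrite ltnn.
  rewrite -andbA; congr (_ && _); rewrite -leqNgt leq_eqVlt.
  case: eqP => [->|yx] /=; first by rewrite ltnn.
  by case: eqP => // /val_inj /enum_rank_inj.
rewrite split2 [X in _ + X](exchange_big_dep (fun x => x \notin tau)) //=; last first.
  by move=> x y _ /andP[].
rewrite -big_split /= big1 // => x xt.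
rewrite [X in _ + X](eq_bigl (fun y => (y \notin tau) && lt x y)); last first.
  by move=> y; rewrite (xt).
rewrite -big_split /= big1 // => y /andP[yt xy].
rewrite /G !rank_insert // -/(lt x y) -/(lt y x) xy.
have -> : lt y x = false by rewrite /lt ltnNge ltnW.
rewrite add1n add0n exprS finset.setUCA mulN1r mulNr mulrN.
by rewrite [X in - X + _]mulrCA addNr.
Qed.

Lemma simplex_chainE (s t : {set T}) : simplex_chain F s t = (t == s)%:R.
Proof. by rewrite ffunE. Qed.

Lemma mem_chains p K c :
  reflect (forall s, c s != 0 -> (s \in K) && (#|s| == p.+1)) (c \in chains F p K).
Proof.
rewrite /chains; set L := [seq _ | _ <- _ & _].
apply: (iffP idP) => [cL s|H].
  rewrite (coord_span (X := in_tuple L) cL) sum_ffunE.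
  case: (boolP (_ && _)) => // sK; rewrite big1 ?eqxx // => i _.
  rewrite ffunE; suff -> : (in_tuple L)`_i s = 0 by rewrite scaler0.
  have /mapP[t] : (in_tuple L)`_i \in L by rewrite mem_nth.
  rewrite mem_filter mem_enum => tK ->; rewrite simplex_chainE.
  by case: eqP => // st; rewrite st andbC tK in sK.
have -> : c = \sum_s c s *: simplex_chain F s.
  apply/ffunP => s; rewrite sum_ffunE (bigD1 s) //= ffunE simplex_chainE eqxx.
  rewrite big1 ?addr0 => [|t ts]; first by rewrite /GRing.scale /= mulr1.
  by rewrite ffunE simplex_chainE eq_sym (negbTE ts) scaler0.
apply: memv_suml => s _; have [->|cs] := eqVneq (c s) 0; first by rewrite scale0r mem0v.
apply: memvZ; apply: memv_span; apply/mapP; exists s => //.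
by rewrite mem_filter mem_enum andbC H.
Qed.

Lemma dim_chains p K : \dim (chains F p K) = #|[set s in K | #|s| == p.+1]%SET|.
Proof.
rewrite /chains; set L := [seq s <- enum K | _].
have uL : uniq L by rewrite filter_uniq // enum_uniq.
have fL : free [seq simplex_chain F s | s <- L].
  apply/(@freeP _ _ _ (in_tuple _)) => k k0 i.
  have iL : (i < size L)%N by rewrite -(size_map (@simplex_chain F T)).
  move/ffunP: k0 => /(_ (nth finset.set0 L i)).
  rewrite sum_ffunE (bigD1 i) //= big1 => [|j ji].
    rewrite addr0 !ffunE (nth_map finset.set0) // simplex_chainE eqxx.
    by rewrite /GRing.scale /= mulr1.
  have jL : (j < size L)%N by rewrite -(size_map (@simplex_chain F T)).
  rewrite ffunE (nth_map finset.set0) // simplex_chainE nth_uniq //.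
  by rewrite eq_sym (negbTE (ji : val j != val i)) scaler0.
rewrite (eqP fL) size_map -sum1_card -sum1_size big_filter big_enum_cond /=.
by apply: eq_bigl => s; rewrite inE.
Qed.

Definition subcomplex K := forall s t : {set T},
  s \in K -> t \subset s -> t != finset.set0 -> t \in K.

Lemma bnd_chains p K c : subcomplex K -> c \in chains F p.+1 K ->
  bnd F T c \in chains F p K.
Proof.
move=> clK /mem_chains cK; apply/mem_chains => tau; rewrite bndE.
case: ifP => [_|/negbT tau0]; first by rewrite eqxx.
apply: contraNT => tauK; rewrite big1 // => x xt.
have [->|/cK /andP[xK xp]] := eqVneq (c (x |: tau)%SET) 0; first by rewrite mulr0.
case/negP: tauK; rewrite (clK _ tau xK) ?finset.subsetUr //=.
by move: xp; rewrite cardsU1 xt add1n eqSS.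
Qed.

Lemma bnd_chains0 K c : c \in chains F 0 K -> bnd F T c = 0.
Proof.
move=> /mem_chains cK; apply/ffunP => tau; rewrite bndE ffunE.
case: eqP => // /eqP tau0; rewrite big1 // => x xt.
have [->|/cK /andP[_]] := eqVneq (c (x |: tau)%SET) 0; first by rewrite mulr0.
by rewrite cardsU1 xt add1n eqSS cards_eq0 (negbTE tau0).
Qed.

Lemma boundaries_sub_cycles p K : subcomplex K ->
  (boundaries F p K <= cycles F p K)%VS.
Proof.
move=> clK; apply/subvP => _ /memv_imgP[c cK ->].
by rewrite memv_cap bnd_chains //= memv_ker bnd_bnd.
Qed.

Lemma cycles0 K : cycles F 0 K = chains F 0 K.
Proof.
apply/eqP; rewrite eqEsubv capvSl subv_cap subvv /=.
by apply/subvP => c /bnd_chains0; rewrite memv_ker => ->.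
Qed.

Lemma dim_cyclesD p K :
  (\dim (cycles F p.+1 K) + \dim (boundaries F p K) = \dim (chains F p.+1 K))%N.
Proof. exact: limg_ker_dim. Qed.

Lemma cyclesS p K L : K \subset L -> (cycles F p K <= cycles F p L)%VS.
Proof.
move=> KL; apply: capvS => //; apply/subvP => c /mem_chains cK.
by apply/mem_chains => s /cK /andP[/(fintype.subsetP KL) -> ->].
Qed.

Lemma boundariesS p K L : K \subset L -> (boundaries F p K <= boundaries F p L)%VS.
Proof.
move=> KL; apply: limgS; apply/subvP => c /mem_chains cK.
by apply/mem_chains => s /cK /andP[/(fintype.subsetP KL) -> ->].
Qed.

Lemma pers_bettiE p K L :
  (pers_betti F p K L + \dim (boundaries F p L) =
   \dim (cycles F p K + boundaries F p L)%VS)%N.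
Proof.
have := dimv_sum_cap (cycles F p K) (boundaries F p L).
have := dimvS (capvSl (cycles F p K) (boundaries F p L)).
by rewrite /pers_betti; lia.
Qed.

Lemma dim_addv_concave (vT : vectType F) (A B C : {vspace vT}) : (A <= B)%VS ->
  (\dim (B + C) + \dim A <= \dim (A + C) + \dim B)%N.
Proof.
move=> AB; have := dimv_sum_cap (A + C)%VS B.
have /dimvS : (A <= (A + C) :&: B)%VS by rewrite subv_cap addvSl AB.
by rewrite -addvA (addvC C) addvA (addv_idPr AB); lia.
Qed.

Lemma pers_betti_concave p K0 K L L' : K0 \subset K -> L \subset L' ->
  (pers_betti F p K L' + pers_betti F p K0 L <=
   pers_betti F p K L + pers_betti F p K0 L')%N.
Proof.
move=> /(cyclesS p) K0K /(boundariesS p) LL'.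
have := dim_addv_concave _ _ _ (boundaries F p L')
  (addvS K0K (subvv (boundaries F p L))).
rewrite -!addvA !(addv_idPr LL').
have := pers_bettiE p K L; have := pers_bettiE p K L'.
have := pers_bettiE p K0 L; have := pers_bettiE p K0 L'.
by lia.
Qed.

Lemma pers_betti_leq p K0 K L : K0 \subset K ->
  (pers_betti F p K0 L <= pers_betti F p K L)%N.
Proof.
move=> /(cyclesS p) K0K; have := dimvS (addvS K0K (subvv (boundaries F p L))).
by have := pers_bettiE p K L; have := pers_bettiE p K0 L; lia.
Qed.

Lemma pers_betti0 p L : pers_betti F p finset.set0 L = 0%N.
Proof.
rewrite /pers_betti; set Z := cycles _ _ _.
suff -> : Z = 0%VS by rewrite dimv0.
apply/eqP; rewrite -subv0; apply/subvP => c; rewrite memv_cap => /andP[/mem_chains c0 _].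
rewrite memv0; apply/eqP/ffunP => s; rewrite ffunE; apply/eqP.
by apply: contraT => /c0; rewrite inE.
Qed.

Lemma pers_betti_diag p K : subcomplex K ->
  (pers_betti F p K K + \dim (chains F p.+1 K) =
   \dim (cycles F p K) + \dim (cycles F p.+1 K))%N.
Proof.
move=> /(boundaries_sub_cycles p) BZ; have := dimvS BZ.
have := dim_cyclesD p K; rewrite /pers_betti (capv_idPr BZ); lia.
Qed.

Lemma euler_poincare n K : subcomplex K -> (forall s, s \in K -> 0 < #|s| <= n)%N ->
  \sum_(p < n) (-1) ^+ p * (pers_betti F p K K)%:Z = - \sum_(s in K) (-1) ^+ #|s|.
Proof.
move=> clK cardK.
have czero : \dim (chains F n K) = 0%N.
  rewrite dim_chains; apply/eqP; rewrite cards_eq0; apply/eqP/finset.setP => s.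
  by rewrite !inE; case: (boolP (s \in K)) => //= /cardK sn; apply/negbTE/eqP; lia.
have zzero : \dim (cycles F n K) = 0%N.
  by have := dimvS (capvSl (chains F n K) (lker (bnd F T))); rewrite czero leqn0 => /eqP.
have telescope N : \sum_(p < N) (-1) ^+ p * (pers_betti F p K K)%:Z =
    \sum_(p < N.+1) (-1) ^+ p * (\dim (chains F p K))%:Z - (-1) ^+ N * (\dim (cycles F N K))%:Z.
  elim: N => [|N IHN].
    by rewrite big_ord0 big_ord_recl big_ord0 addr0 !expr0 cycles0 subrr.
  rewrite big_ord_recr IHN /= [in RHS]big_ord_recr /= exprS.
  have := pers_betti_diag N K clK.
  move: (\dim (chains F N.+1 K)) (\dim (cycles F N K)) (\dim (cycles F N.+1 K)) (pers_betti _ _ _ _).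
  move=> a b c d abcd; have -> : d%:Z = b%:Z + c%:Z - a%:Z by lia.
  by ring.
rewrite telescope zzero mulr0 subr0 big_ord_recr /= czero mulr0 addr0.
rewrite -sumrN (eq_bigr (fun s : {set T} => (-1) ^+ #|s|.-1)); last first.
  by move=> s /cardK; case: #|s| => // i _; rewrite exprS mulN1r opprK.
rewrite (partition_big (fun s : {set T} => inord #|s|.-1 : 'I_n.-1.+1) predT) //=.
case: n cardK czero zzero => [|n] cardK _ _.
  rewrite big_ord0 big1 // => i _; rewrite big1 // => s /andP[/cardK]; lia.
apply: eq_bigr => p _; rewrite dim_chains -sum1_card.
rewrite -[Posz _]natz natr_sum mulr_sumr [RHS](eq_bigl (mem [set s in K | #|s| == p.+1]%SET)) /=; last first.
  move=> s; rewrite !inE; case: (boolP (s \in K)) => //= /cardK cs.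
  by rewrite -val_eqE /= inordK; lia.
by apply: eq_bigr => s; rewrite inE => /andP[_ /eqP ->]; rewrite mulr1.
Qed.

End Homology.

(** * Bars alive at a level *)

(* P i j is the rank of the map from stage i to stage j; the summands are
   [mult] and [mult_oo], whose truncated subtractions are harmless because of the
   last two hypotheses. *)
Lemma alive_telescope (P : nat -> nat -> nat) (n l : nat) : (l <= n)%N ->
  (forall j, P 0%N j = 0%N) ->
  (forall i j, (i < n)%N -> P i j <= P i.+1 j)%N ->
  (forall i j, (i < n)%N -> (j < n)%N ->
     P i.+1 j.+1 + P i j <= P i.+1 j + P i j.+1)%N ->
  (\sum_(1 <= i < n.+1) \sum_(i.+1 <= j < n.+1)
     ((i <= l) && (l < j)) * ((P i j.-1 + P i.-1 j) - (P i j + P i.-1 j.-1)) +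
   \sum_(1 <= i < n.+1) (i <= l) * (P i n - P i.-1 n) = P l l)%N.
Proof.
move=> ln P0 Pmono Pconc.
have inner i N : (i < l)%N -> (l <= N)%N -> (N <= n)%N -> (\sum_(i.+2 <= j < N.+1)
     (l < j) * ((P i.+1 j.-1 + P i j) - (P i.+1 j + P i j.-1)) +
     (P i.+1 N - P i N) = P i.+1 l - P i l)%N.
  move=> il; elim: N => [|N IHN] lN Nn; first by lia.
  move: lN; rewrite leq_eqVlt => /predU1P[lN|lN].
    rewrite -lN big_nat big1 // => j jl; rewrite ltnNge; suff -> : (j <= l)%N by [].
    by lia.
  rewrite big_nat_recr /=; last by lia.
  rewrite lN mul1n -IHN //; last by lia.
  have := Pconc i N; have := Pmono i N; have := Pmono i N.+1.
  by lia.
rewrite -big_split /=.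
transitivity (\sum_(1 <= i < n.+1) (i <= l) * (P i l - P i.-1 l))%N.
  apply: eq_big_nat => -[//|i] /= _.
  case: ltnP => il; first by rewrite !mul1n -(inner i n).
  by rewrite big1.
have outer N : (N <= n)%N ->
    (\sum_(1 <= i < N.+1) (i <= l) * (P i l - P i.-1 l) = P (minn N l) l)%N.
  elim: N => [|N IHN] Nn; first by rewrite big_geq // min0n P0.
  rewrite big_nat_recr //= IHN; last by lia.
  case: (ltnP N l) => Nl; last by rewrite (minn_idPr (leqW Nl)) mul0n addn0.
  rewrite (minn_idPl Nl) mul1n.
  by have := Pmono N l Nn; lia.
by rewrite outer // (minn_idPr ln).
Qed.

Section Alive.
Context {R : realType}.

Definition alive (r : R) (u : R * \bar R) : bool := (u.1 <= r) && (r%:E < u.2)%E.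

Definition gap (r e : R) (v : R) : bool := (v <= r - e) || (r + e < v).

Lemma count_matching (D1 D2 : diagram R) (e r : R) : 0 <= e ->
  (forall u, u \in D1 ++ D2 -> gap r e u.1 /\ (u.2 = +oo%E \/ exists2 d, u.2 = d%:E & gap r e d)) ->
  matching D1 D2 e -> count (alive r) D1 = count (alive r) D2.
Proof.
move=> e0 gapD [M [U1 [U2 [D1E D2E hM hU]]]].
have {}gapD u : [|| u \in unzip1 M, u \in unzip2 M, u \in U1 | u \in U2] ->
    gap r e u.1 /\ (u.2 = +oo%E \/ exists2 d, u.2 = d%:E & gap r e d).
  move=> uMU; apply: gapD; rewrite mem_cat (perm_mem D1E) (perm_mem D2E) !mem_cat.
  by case/or4P: uMU => ->; rewrite ?orbT.
rewrite (permP D1E) (permP D2E) !count_cat.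
have U0 (U : diagram R) : {subset U <= U1 ++ U2} -> count (alive r) U = 0%N.
  move=> sU; apply/eqP; rewrite -leqn0 leqNgt -has_count; apply/hasPn => u /sU uU.
  have [|gb gd] := gapD u; first by move: uU; rewrite mem_cat => /orP[] ->; rewrite !orbT.
  have := hU u uU; rewrite /alive /diag_dist.
  case: gd => [->|[d -> gd]].
    by rewrite addye // mulyr gtr0_sg ?invr_gt0 // mul1e leye_eq.
  rewrite -EFinB -EFinM lee_fin lte_fin; move: gb gd; rewrite /gap.
  by move=> /orP[] ? /orP[] ? ?; apply/negP => /andP[]; lra.
rewrite (U0 U1) ?(U0 U2) ?addn0; first last.
- by move=> u uU; rewrite mem_cat uU.
- by move=> u uU; rewrite mem_cat uU orbT.
rewrite !count_map; apply: eq_in_count => uv uvM /=.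
have := hM _ uvM; rewrite /pt_dist ge_max => /andP[].
have [|gb1 gd1] := gapD uv.1; first by rewrite map_f.
have [|gb2 gd2] := gapD uv.2; first by rewrite (map_f snd) ?orbT.
rewrite lee_fin ler_norml => /andP[b12 b21] dd.
have -> : alive r uv.1 = (uv.1.1 <= r) && (r%:E < uv.1.2)%E by [].
have -> : alive r uv.2 = (uv.2.1 <= r) && (r%:E < uv.2.2)%E by [].
congr (_ && _).
  by move: gb1 gb2; rewrite /gap => /orP[] ? /orP[] ?; apply/idP/idP; lra.
move: dd; rewrite /death_dist.
case: gd1 => [->|[d1 -> gd1]]; case: gd2 => [->|[d2 -> gd2]] //.
rewrite eqe; case: eqP => [-> //|_]; rewrite lee_fin ler_norml => /andP[? ?].
rewrite !lte_fin.
by move: gd1 gd2; rewrite /gap => /orP[] ? /orP[] ?; apply/idP/idP; lra.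
Qed.

End Alive.

Section Barcode.
Context {R : realType} (F : fieldType) (W : choiceType).
Context (f : {fset W} -> R) (m : nat) (S : {fset W}).

Let c := crit f m S.

Lemma crit_sorted : sorted <=%R c.
Proof. exact/sort_sorted/le_total. Qed.

Lemma mem_crit s : s \in skeleton m S -> fvalue f s \in c.
Proof. by move=> sS; rewrite mem_sort mem_undup map_f // mem_enum. Qed.

Lemma critP v : v \in c -> exists2 s, s \in skeleton m S & v = fvalue f s.
Proof.
by rewrite mem_sort mem_undup => /mapP[s]; rewrite mem_enum => sS ->; exists s.
Qed.

Lemma nth_crit_le r i : (i < size c)%N -> (c`_i <= r) = (i < count (<= r) c)%N.
Proof.
move=> ic; case: ltnP => il; first exact: nth_count_le crit_sorted il.
by apply/negbTE; rewrite -ltNge (nth_count_gt 0 crit_sorted) // il.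
Qed.

Lemma sublevel_stage r : sublevel f m S r = stage f m S (count (<= r) c).
Proof.
apply/finset.setP => s; case cE: (count _ c) => [|l] /=; rewrite !inE.
  apply/negbTE/negP => /andP[sS sr]; have := mem_crit s; rewrite inE => /(_ sS) sc.
  by move/eqP: cE; rewrite -leqn0 leqNgt -has_count => /hasP[]; exists (fvalue f s).
case sS: (0 < #|s| <= m.+1)%N => //=; have := mem_crit s; rewrite inE sS.
move=> /(_ isT) sc; have := nth_index 0 sc; set i := index _ _ => <-.
have ic : (i < size c)%N by rewrite index_mem.
have lc : (l < size c)%N by rewrite -cE count_size.
rewrite nth_crit_le // cE ltnS; apply/idP/idP => il.
  exact: (sorted_leq_nth le_trans le_refl 0 crit_sorted).
rewrite -ltnS -cE -nth_crit_le // (le_trans il) //.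
by rewrite nth_crit_le // cE.
Qed.

Lemma stage_subset i : (i < size c)%N -> stage f m S i \subset stage f m S i.+1.
Proof.
case: i => [|i] ic /=; first exact: finset.sub0set.
apply/fintype.subsetP => s; rewrite !inE => /andP[-> /= si]; apply: le_trans si _.
by apply: (sorted_leq_nth le_trans le_refl 0 crit_sorted); rewrite ?inE // ltnW.
Qed.

Lemma count_alive_dgm p r :
  count (alive r) (dgm F f m S p) = pers_betti F p (sublevel f m S r) (sublevel f m S r).
Proof.
rewrite sublevel_stage; set l := count (<= r) c.
have ln : (l <= size c)%N by exact: count_size.
rewrite -[RHS](alive_telescope (pbetti F f m S p) (size c)) //; last first.
- move=> i j ic jc; apply: pers_betti_concave; exact: stage_subset.
- move=> i j ic; apply: pers_betti_leq; exact: stage_subset.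
- by move=> j; exact: pers_betti0.
rewrite /dgm -/c count_cat !count_flatten !sumnE !big_map big_allpairs_dep /=.
rewrite /index_iota subSS subn0; congr (_ + _)%N.
  apply: eq_big_seq => i; rewrite mem_iota => iI; rewrite subSS.
  apply: eq_big_seq => j; rewrite mem_iota => jI.
  rewrite count_nseq /alive /= lte_fin ltNge !nth_crit_le -/l; try lia.
  by congr (nat_of_bool _ * _)%N; lia.
apply: eq_big_seq => i; rewrite mem_iota => iI.
rewrite count_nseq /alive /= ltry andbT nth_crit_le -/l; last by lia.
by congr (nat_of_bool _ * _)%N; lia.
Qed.

Lemma dgm_gap p r e u : (forall s, s \in skeleton m S -> gap r e (fvalue f s)) ->
  u \in dgm F f m S p -> gap r e u.1 /\ (u.2 = +oo%E \/ exists2 d, u.2 = d%:E & gap r e d).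
Proof.
move=> gapS.
have gapc i : (0 < i <= size c)%N -> gap r e c`_i.-1.
  move=> ic; have ic1 : (i.-1 < size c)%N by lia.
  have /critP[s sS ->] := mem_nth 0 ic1.
  exact: gapS.
rewrite mem_cat => /orP[] /flattenP[z].
  move=> /allpairsPdep[i [j [iI jI ->]]] /nseqP[-> _] /=.
  move: iI jI; rewrite !mem_iota -/c => iI jI.
  split; first by apply: gapc; lia.
  by right; exists c`_j.-1 => //; apply: gapc; lia.
move=> /mapP[i iI ->] /nseqP[-> _] /=.
by split; [apply: gapc; move: iI; rewrite mem_iota -/c; lia | left].
Qed.

End Barcode.

(** * Euler characteristics of skeleta *)

Section EulerCharacteristic.
Context {R : realType}.

Definition fmonotone {W : choiceType} (f : {fset W} -> R) :=
  forall s t : {fset W}, s != fset0 -> (s `<=` t)%fset -> f s <= f t.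

Definition ecc {W : choiceType} (f : {fset W} -> R) m (S : {fset W}) (r : R) : int :=
  \sum_(s in sublevel f m S r) (-1) ^+ #|s|.

Lemma subcomplex_sublevel (W : choiceType) (f : {fset W} -> R) m S r :
  fmonotone f -> subcomplex _ (sublevel f m S r).
Proof.
move=> fmono s t; rewrite !inE => /andP[/andP[s0 sm] sr] ts t0.
rewrite card_gt0 t0 (leq_trans (subset_leq_card ts)) //=.
apply: le_trans sr; apply: fmono.
  have /set0Pn[x xt] := t0.
  by apply/fset0Pn; exists (fsval x); apply/imfsetP; exists x.
apply/fsubsetP => _ /imfsetP[x /= xt ->]; apply/imfsetP; exists x => //=.
exact: (fintype.subsetP ts).
Qed.

Lemma eq_ecc (F : fieldType) (W W' : choiceType) (f : {fset W} -> R)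
    (f' : {fset W'} -> R) m S S' (r e : R) : 0 <= e ->
  fmonotone f -> fmonotone f' ->
  (forall s, s \in skeleton m S -> gap r e (fvalue f s)) ->
  (forall s, s \in skeleton m S' -> gap r e (fvalue f' s)) ->
  (forall p, matching (dgm F f m S p) (dgm F f' m S' p) e) ->
  ecc f m S r = ecc f' m S' r.
Proof.
move=> e0 fmono f'mono gapf gapf' mtch; apply: oppr_inj; rewrite /ecc.
have sk (V : choiceType) (h : {fset V} -> R) (X : {fset V}) (s : {set X}) :
    s \in sublevel h m X r -> (0 < #|s| <= m.+1)%N.
  by rewrite !inE => /andP[].
rewrite -!(euler_poincare F _ m.+1); try exact: sk; try exact: subcomplex_sublevel.
apply: eq_bigr => p _; rewrite -!count_alive_dgm; congr (_ * Posz _).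
apply: count_matching e0 _ (mtch p) => u.
by rewrite mem_cat => /orP[] /dgm_gap; apply.
Qed.

Lemma big_fset_image (V : nmodType) (W : choiceType) (T : finType) (psi : T -> W)
    (A : {set T}) (n : nat) (G : nat -> {fset W} -> V) : {in A &, injective psi} ->
  \sum_(s : {set [fset psi x | x in A]%fset} | (0 < #|s| <= n)%N)
     G #|s| [fset fsval x | x in s]%fset =
  \sum_(s : {set T} | (s \subset A) && (0 < #|s| <= n)%N)
     G #|s| [fset psi x | x in s]%fset.
Proof.
move=> psi_inj; set U := [fset psi x | x in A]%fset.
pose h (s : {set T}) : {set U} := [set u | fsval u \in [fset psi x | x in s]%fset]%SET.
pose h' (t : {set U}) : {set T} := [set x in A | psi x \in [fset fsval u | u in t]%fset]%SET.
have hE (s : {set T}) : s \subset A ->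
    [fset fsval u | u in h s]%fset = [fset psi x | x in s]%fset.
  move=> /fintype.subsetP sA; apply/fsetP => w; apply/imfsetP/imfsetP => /=.
    by move=> [u]; rewrite inE => /imfsetP[x /= xs ux] ->; exists x.
  move=> [x xs ->]; have xU : psi x \in U by apply/imfsetP; exists x => //=; exact: sA.
  by exists [` xU]%fset; rewrite ?inE //=; apply/imfsetP; exists x.
have cE (s : {set T}) : s \subset A -> #|h s| = #|s|.
  move=> sA; have := congr1 (fun X : {fset W} => #|` X|) (hE s sA).
  rewrite card_imfset /=; last exact: val_inj.
  rewrite card_in_imfset /=; first by rewrite -!cardE.
  by move=> x y xs ys; apply: psi_inj; exact: (fintype.subsetP sA).
rewrite (reindex_onto h h') /=; last first.
  move=> t _; apply/finset.setP => u; rewrite inE; apply/imfsetP/idP => /=.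
    by move=> [x]; rewrite inE => /andP[_ /imfsetP[v /= vt ->]] /val_inj ->.
  move=> ut; have /imfsetP[x /= xA ux] := fsvalP u.
  by exists x => //; rewrite inE xA -ux /=; apply/imfsetP; exists u.
rewrite (eq_bigl (fun s : {set T} => (s \subset A) && (0 < #|s| <= n)%N)); last first.
  move=> s; case: (boolP (s \subset A)) => sA /=.
    rewrite cE //; suff -> : h' (h s) == s by rewrite andbT.
    apply/eqP/finset.setP => x; rewrite inE hE //; apply/andP/idP => [[xA]|xs].
      move=> /imfsetP[y /= ys /psi_inj-> //]; exact: (fintype.subsetP sA).
    by split; [exact: (fintype.subsetP sA) | apply/imfsetP; exists x].
  apply/negbTE; rewrite negb_and; apply/orP; right; apply: contra sA => /eqP <-.
  by apply/fintype.subsetP => x; rewrite inE => /andP[].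
by apply: eq_bigr => s /andP[sA _]; rewrite cE // hE.
Qed.

(* If psi x = psi y with x != y, the sets containing x cancel in pairs s, y |: s,
   so x may be dropped. *)
Lemma sum_collapse (W : choiceType) (T : finType) (psi : T -> W)
    (A : {set T}) (G : {fset W} -> int) : exists B : {set T},
  [/\ B \subset A, {in B &, injective psi},
    [fset psi x | x in B]%fset = [fset psi x | x in A]%fset &
    \sum_(s : {set T} | (s \subset A) && (0 < #|s|)%N) (-1) ^+ #|s| * G [fset psi x | x in s]%fset =
    \sum_(s : {set T} | (s \subset B) && (0 < #|s|)%N) (-1) ^+ #|s| * G [fset psi x | x in s]%fset].
Proof.
elim: {A}_.+1 {-2}A (ltnSn #|A|) => // n IHn A; rewrite ltnS => An.
have [psi_inj|] := pselect {in A &, injective psi}; first by exists A.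
move=> /existsNP[x /existsNP[y]].
rewrite !not_implyE => -[xA [yA [pxy xy]]].
have [|B [BA Binj BE Bsum]] := IHn (A :\ x)%SET.
  by move: An; rewrite (cardsD1 x) xA.
exists B; split => //; first by rewrite (fintype.subset_trans BA) // finset.subD1set.
  rewrite BE; apply/fsetP => w; apply/imfsetP/imfsetP => -[z /= zA ->].
    by exists z => //; move: zA; rewrite !inE => /andP[].
  have [->|zx] := eqVneq z x; last by exists z; rewrite ?inE ?zx.
  by exists y => //; rewrite !inE yA andbT; apply/eqP => yx; apply: xy.
rewrite -Bsum (bigID (fun s : {set T} => x \in s)) /=.
rewrite [X in X + _](_ : _ = 0) ?add0r; last first.
  rewrite (bigID (fun s : {set T} => y \in s)) /=.
  rewrite (reindex_onto (fun s : {set T} => y |: s)%SET (fun s : {set T} => s :\ y)%SET) /=; last first.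
    by move=> s /andP[_ ys]; rewrite finset.setD1K.
  rewrite (eq_bigl (fun s : {set T} => ((s \subset A) && (0 < #|s|)%N && (x \in s)) && (y \notin s))); last first.
    move=> s; rewrite finset.subUset finset.sub1set yA finset.setU11 andbT /= finset.in_setU1.
    rewrite (_ : (x == y) = false) /=; last by apply/eqP.
    have [ys|ys] := boolP (y \in s).
      rewrite (_ : (_ == s) = false) ?andbF //; apply/eqP => ysE.
      by move: ys; rewrite -ysE !inE eqxx.
    rewrite finset.setU1K // eqxx !andbT; case: (boolP (x \in s)) => xs; rewrite ?andbF // !andbT.
    by congr (_ && _); rewrite cardsU1 ys (cardD1 x s) xs.
  rewrite -big_split /= big1 // => s /andP[/andP[_ xs] ys].
  rewrite cardsU1 ys exprS mulN1r mulNr; apply/eqP; rewrite addrC subr_eq0; apply/eqP.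
  congr (_ * G _); apply/fsetP => w; apply/imfsetP/imfsetP => -[z /= zs ->].
    by exists z => //; rewrite inE zs orbT.
  by move: zs; rewrite !inE => /predU1P[->|zs]; [exists x | exists z].
apply: eq_bigl => s; rewrite finset.subsetD1.
by case: (s \subset A) => //=; rewrite andbC.
Qed.

Lemma ecc_image (W : choiceType) (f : {fset W} -> R) m r (T : finType)
    (psi : T -> W) (A : {set T}) : {in A &, injective psi} \/ (#|A| <= m.+1)%N ->
  ecc f m [fset psi x | x in A]%fset r =
  \sum_(s : {set T} | (s \subset A) && (0 < #|s| <= m.+1)%N)
     (-1) ^+ #|s| * (f [fset psi x | x in s]%fset <= r)%R%:R.
Proof.
have eccE S : ecc f m S r = \sum_(s : {set S} | (0 < #|s| <= m.+1)%N)
    (-1) ^+ #|s| * (f [fset fsval x | x in s]%fset <= r)%R%:R.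
  rewrite [RHS](bigID (fun s => fvalue f s <= r)) /= [X in _ + X]big1 ?addr0.
    by apply: eq_big => [s|s]; rewrite !inE // => /andP[_]; rewrite /fvalue => ->; rewrite mulr1.
  by move=> s /andP[_ /negbTE sr]; rewrite -/(fvalue f s) sr mulr0.
have inj (B : {set T}) : {in B &, injective psi} ->
  ecc f m [fset psi x | x in B]%fset r =
  \sum_(s : {set T} | (s \subset B) && (0 < #|s| <= m.+1)%N)
     (-1) ^+ #|s| * (f [fset psi x | x in s]%fset <= r)%R%:R.
  move=> Binj; rewrite eccE.
  exact: (big_fset_image int W T psi B m.+1 (fun n s => (-1) ^+ n * (f s <= r)%R%:R) Binj).
move=> [/inj //|Am].
have [B [BA Binj <- sumE]] := sum_collapse W T psi A (fun s => (f s <= r)%R%:R).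
rewrite inj //.
have cut (C : {set T}) : C \subset A ->
    \sum_(s : {set T} | (s \subset C) && (0 < #|s|)%N)
       (-1) ^+ #|s| * (f [fset psi x | x in s]%fset <= r)%R%:R =
    \sum_(s : {set T} | (s \subset C) && (0 < #|s| <= m.+1)%N)
       (-1) ^+ #|s| * (f [fset psi x | x in s]%fset <= r)%R%:R :> int.
  move=> CA; apply: eq_bigl => s; case: (boolP (s \subset C)) => //= sC.
  by rewrite (leq_trans (subset_leq_card (fintype.subset_trans sC CA)) Am) andbT.
by rewrite -!cut // sumE.
Qed.

Lemma sum_signed_bin n j :
  \sum_(i < j.+1) (-1) ^+ i * 'C(n.+1, i)%:Z = (-1) ^+ j * 'C(n, j)%:Z.
Proof.
elim: j => [|j IHj]; first by rewrite big_ord1 !bin0.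
rewrite big_ord_recr IHj /= binS PoszD exprS; ring.
Qed.

Lemma sum_sign_card (T : finType) n m : #|T| = n.+1 ->
  \sum_(s : {set T} | (0 < #|s| <= m.+1)%N) (-1) ^+ #|s| =
  (-1) ^+ m.+1 * 'C(n, m.+1)%:Z - 1 :> int.
Proof.
move=> cT; rewrite -sum_signed_bin big_ord_recl expr0 bin0 mul1r addrC addKr.
rewrite (partition_big (fun s : {set T} => inord #|s|.-1 : 'I_m.+1) predT) //=.
apply: eq_bigr => i _.
rewrite (eq_bigl (mem [set s : {set T} | #|s| == i.+1]%SET)) /=; last first.
  move=> s; rewrite !inE; case: (posnP #|s|) => [->//|s0] /=.
  case: (leqP #|s| m.+1) => sm /=; first by rewrite -val_eqE /= inordK; lia.
  by apply/esym/eqP; have := ltn_ord i; lia.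
rewrite (eq_bigr (fun _ => (-1) ^+ i.+1)); last by move=> s; rewrite inE => /eqP ->.
by rewrite sumr_const -cT card_draws -mulr_natr natz.
Qed.

Lemma mobius_vanish (V : zmodType) (T : finType) (n : nat) (g : {set T} -> V) :
  (forall B : {set T}, (#|~: B| <= n)%N -> \sum_(s : {set T} | s \subset B) g s = 0) ->
  (forall s : {set T}, (n < #|s|)%N -> g s = 0) -> forall s, g s = 0.
Proof.
move=> g0 gbig.
have upper j (A B : {set T}) : #|A| = j -> (#|A| + #|~: B| <= n)%N ->
    \sum_(s : {set T} | (A \subset s) && (s \subset B)) g s = 0.
  elim: j A B => [|j IHj] A B Aj ABn.
    move/eqP: Aj; rewrite cards_eq0 => /eqP A0; rewrite -[RHS](g0 B); last by lia.
    by apply: eq_bigl => s; rewrite A0 finset.sub0set.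
  have /card_gt0P[x xA] : (0 < #|A|)%N by rewrite Aj.
  have Ax : #|A :\ x|%SET = j by move: Aj; rewrite (cardsD1 x) xA => -[].
  have ABn' : (#|(A :\ x)%SET| + #|~: B| <= n)%N by lia.
  have := IHj (A :\ x)%SET B Ax ABn'; rewrite (bigID (fun s : {set T} => x \in s)) /=.
  rewrite [X in _ + X](_ : _ = 0) ?addr0; last first.
    rewrite -[RHS](IHj (A :\ x)%SET (B :\ x)%SET Ax).
      by apply: eq_bigl => s; rewrite finset.subsetD1 -andbA.
    have : (#|~: (B :\ x)| <= #|~: B| + 1)%N.
      rewrite finset.setCD -[1%N](cards1 x); exact: leq_card_setU.
    by lia.
  move=> sum0; rewrite -[RHS]sum0.
  apply: eq_bigl => s; have -> : (A \subset s) = (x \in s) && (A :\ x \subset s)%SET.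
    by rewrite -finset.sub1set -finset.subUset finset.setD1K.
  by rewrite -andbA andbC.
move=> s; elim: {s}_.+1 {-2}s (ltnSn (#|T| - #|s|)%N) => // j IHj s; rewrite ltnS => sj.
case: (leqP #|s| n) => [sn|/gbig //].
rewrite -[RHS](upper #|s| s [set: T]%SET erefl); last by rewrite finset.setCT cards0 addn0.
rewrite (bigD1 s) ?fintype.subxx ?subsetT //= big1 ?addr0 // => t /andP[/andP[st _] ts].
apply: IHj; have : (#|s| < #|t|)%N by apply: proper_card; rewrite finset.properEneq eq_sym ts.
by have := max_card t; lia.
Qed.

End EulerCharacteristic.

(** * Comparison of filtration values *)

Lemma exists_gap {R : realType} (V : seq R) (a b e : R) : 0 < e ->
  a + (2 * size V + 1)%:R * e < b ->
  exists r, [/\ a <= r, r < b & forall v, v \in V -> gap r e v].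
Proof.
move=> e0 ab; pose r (j : nat) := a + (2 * j + 1)%:R * e.
have [[j jV jgap]|nogap] := pselect (exists2 j, (j <= size V)%N &
    forall v, v \in V -> gap (r j) e v).
  exists (r j); split => //.
    by rewrite lerDl mulr_ge0 ?ler0n // ltW.
  apply: le_lt_trans ab; rewrite lerD2l ler_pM2r // ler_nat; lia.
have hasv j : (j <= size V)%N -> has (fun v => ~~ gap (r j) e v) V.
  move=> jV; apply: contra_notT nogap => /hasPn h; exists j => // v /h.
  by rewrite negbK.
pose v j := nth 0 V (find (fun v => ~~ gap (r j) e v) V).
have vgap j : (j <= size V)%N -> ~~ gap (r j) e (v j).
  by move=> /hasv /(nth_find 0).
have vle i j : (i <= size V)%N -> (j <= size V)%N -> v i = v j -> (i <= j)%N.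
  move=> iV jV vij; have := vgap i iV; have := vgap j jV.
  rewrite -vij /gap !negb_or -!ltNge -!leNgt /r (natrD _ (2 * i)%N) (natrD _ (2 * j)%N).
  rewrite !natrM => /andP[_ ji] /andP[ij _].
  have : (i%:R < j.+1%:R :> R)%R.
    rewrite -(ltr_pM2r e0) -natr1; move: ij ji; move: (v i) (i%:R) (j%:R) => w x y; lra.
  by rewrite ltr_nat.
have uv : uniq [seq v j | j <- iota 0 (size V).+1].
  rewrite map_inj_in_uniq ?iota_uniq // => i j; rewrite !mem_iota /= !add0n !ltnS => iV jV vij.
  by apply: anti_leq; rewrite (vle i j) // (vle j i).
have : (size [seq v j | j <- iota 0 (size V).+1] <= size V)%N; last first.
  by rewrite size_map size_iota ltnn.
apply: uniq_leq_size uv _ => z /mapP[j]; rewrite mem_iota /= add0n ltnS => jV ->; apply: mem_nth.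
by rewrite -has_find hasv.
Qed.

Section Comparison.
Context {R : realType} (F : fieldType) (W W' : choiceType) (phi : W -> W').
Context (f : {fset W} -> R) (f' : {fset W'} -> R) (m : nat) (S : {fset W}) (e : R).
Context (fmono : fmonotone f) (f'mono : fmonotone f') (e_gt0 : 0 < e).
Context (mS : (m < #|` S|)%N).
Context (closeS : forall S' : {fset W}, (S' `<=` S)%fset ->
   (#|` S| - m - 1 <= #|` S'|)%N -> forall p,
   matching (dgm F f m S' p) (dgm F f' m [fset phi x | x in S']%fset p) e).

Definition gap_on (V : choiceType) (h : {fset V} -> R) (X : {fset V}) (r : R) :=
  forall s : {fset V}, (s `<=` X)%fset -> (0 < #|` s| <= m.+1)%N -> gap r e (h s).

Lemma gap_skeleton (V : choiceType) (h : {fset V} -> R) (X X' : {fset V}) r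
    (s : {set X'}) : (X' `<=` X)%fset -> gap_on V h X r ->
  s \in skeleton m X' -> gap r e (fvalue h s).
Proof.
move=> /fsubsetP X'X hgap; rewrite inE => scard; apply: hgap.
  by apply/fsubsetP => _ /imfsetP[x _ ->]; apply: X'X; exact: fsvalP.
by rewrite card_imfset /=; [rewrite -cardE | exact: val_inj].
Qed.

Lemma ecc_gap r (S' : {fset W}) : gap_on W f S r ->
  gap_on W' f' [fset phi x | x in S]%fset r ->
  (S' `<=` S)%fset -> (#|` S| - m - 1 <= #|` S'|)%N ->
  ecc f m S' r = ecc f' m [fset phi x | x in S']%fset r.
Proof.
move=> gapf gapf' S'S S'card; apply: (eq_ecc F) (closeS S' S'S S'card) => //.
- exact: ltW.
- move=> s; exact: gap_skeleton gapf.
- move=> s; apply: gap_skeleton gapf'.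
  by apply/fsubsetP => _ /imfsetP[x /= xS' ->]; apply/imfsetP; exists x => //=; exact: (fsubsetP S'S).
Qed.

Lemma ecc_full (X : {fset W}) (r : R) n : (X `<=` S)%fset -> #|` X| = n.+1 ->
  (forall s, (s `<=` S)%fset -> f s <= r) ->
  ecc f m X r = (-1) ^+ m.+1 * 'C(n, m.+1)%:Z - 1.
Proof.
move=> XS cX fr; rewrite -(sum_sign_card X n m); last by rewrite -cardfE.
apply: eq_bigl => s; rewrite !inE (_ : (fvalue f s <= r) = true) ?andbT //.
apply: fr; apply/fsubsetP => _ /imfsetP[x _ ->]; apply: (fsubsetP XS); exact: fsvalP.
Qed.

(* If phi x = phi y, then S and S minus x have the same image, hence full
   m-skeleta with the same Euler characteristic. *)
Lemma inj_or_small : {in S &, injective phi} \/ (#|` S| <= m.+1)%N.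
Proof.
have [|mS2] := leqP; first by right.
left; move=> x y xS yS pxy; apply/eqP/negP => /negP xy.
pose B := \big[Num.max/0]_(s <- fpowerset S) f s.
pose B' := \big[Num.max/0]_(s <- fpowerset [fset phi x | x in S]%fset) f' s.
have fB s : (s `<=` S)%fset -> f s <= B.
  by move=> sS; apply: le_bigmax_seq => //; rewrite fpowersetE.
have fB' s : (s `<=` [fset phi x | x in S])%fset -> f' s <= B'.
  by move=> sS; apply: le_bigmax_seq => //; rewrite fpowersetE.
pose r := Num.max B B' + e.
have gapf : gap_on W f S r.
  by move=> s /fB sB _; rewrite /gap addrK le_max sB.
have gapf' : gap_on W' f' [fset phi x | x in S]%fset r.
  by move=> s /fB' sB _; rewrite /gap addrK le_max sB orbT.
have Sx : (S `\ x `<=` S)%fset by exact: fsubD1set.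
have cSx : #|` S| = #|` (S `\ x)%fset|.+1 by rewrite (cardfsD1 x) xS.
have Sk : (#|` S| - m - 1 <= #|` S|)%N by lia.
have := ecc_gap r S gapf gapf' (fsubset_refl S) Sk.
have -> : [fset phi x | x in S]%fset = [fset phi z | z in (S `\ x)%fset]%fset.
  apply/fsetP => w; apply/imfsetP/imfsetP => -[z /= zS ->]; last first.
    by exists z => //; exact: (fsubsetP Sx).
  have [->|zx] := eqVneq z x; last by exists z => //; rewrite !inE zx.
  by exists y; rewrite // !inE eq_sym xy.
rewrite -(ecc_gap r _ gapf gapf' Sx); last by lia.
have fr s : (s `<=` S)%fset -> f s <= r.
  by move=> /fB sB; rewrite /r -[f s]addr0 lerD ?le_max ?sB // ltW.
case cE : #|` (S `\ x)%fset| => [|n]; first by lia.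
rewrite (ecc_full _ _ _ Sx cE fr) (ecc_full _ _ n.+1 (fsubset_refl S)) ?cSx ?cE //.
move=> /(congr1 (+%R^~ 1)); rewrite !subrK => /(inv_inj (signrMK m.+1)) [] /eqP.
rewrite binS -[X in _ == X]addn0 eqn_add2l.
by rewrite -leqn0 leqNgt bin_gt0; lia.
Qed.

Lemma sublevel_transfer (r : R) : gap_on W f S r ->
  gap_on W' f' [fset phi x | x in S]%fset r ->
  forall s : {fset W}, (s `<=` S)%fset -> (0 < #|` s| <= m.+1)%N ->
  (f s <= r) = (f' [fset phi x | x in s]%fset <= r).
Proof.
move=> gapf gapf' s sS scard.
pose im (V : choiceType) (h : S -> V) (t : {set S}) := [fset h x | x in t]%fset.
pose g (t : {set S}) : int := if (0 < #|t| <= m.+1)%N then (-1) ^+ #|t| *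
   ((f (im _ (@fsval _ S) t) <= r)%R%:R - (f' (im _ (phi \o @fsval _ S) t) <= r)%R%:R) else 0.
have g0 : forall t, g t = 0.
  apply: (mobius_vanish _ _ m.+1) => [B Bm|t tm]; last first.
    by rewrite /g (leqNgt _ m.+1) tm andbF.
  have cB : #|` im _ (@fsval _ S) B| = #|B|.
    by rewrite card_imfset /=; [rewrite -cardE | exact: val_inj].
  have BS : (im _ (@fsval _ S) B `<=` S)%fset.
    by apply/fsubsetP => _ /imfsetP[x _ ->]; exact: fsvalP.
  have := ecc_gap r (im _ (@fsval _ S) B) gapf gapf' BS; rewrite cB.
  have := cardsC B; rewrite -cardfE => cBC.
  have Bk : (#|` S| - m - 1 <= #|B|)%N by lia.
  move=> /(_ Bk).
  have -> : [fset phi x | x in im _ (@fsval _ S) B]%fset = im _ (phi \o @fsval _ S) B.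
    apply/fsetP => w; apply/imfsetP/imfsetP => [[_ /imfsetP[x /= xB ->] ->]|[x /= xB ->]].
      by exists x.
    by exists (fsval x) => //; apply/imfsetP; exists x.
  rewrite !ecc_image; last first.
  - by left; move=> x y _ _; exact: val_inj.
  - case: inj_or_small => [phi_inj|Sm]; [left|right].
      by move=> x y _ _ /phi_inj xy; apply/val_inj/xy; exact: fsvalP.
    by rewrite (leq_trans _ Sm) // cardfE max_card.
  move=> /eqP; rewrite -subr_eq0 -sumrB => /eqP sum0.
  rewrite -[RHS]sum0 [RHS]big_mkcondr; apply: eq_bigr => t _; rewrite /g.
  by case: ifP => // _; rewrite mulrBr.
pose t : {set S} := [set x | fsval x \in s]%SET.
have ts : im _ (@fsval _ S) t = s.
  apply/fsetP => x; apply/imfsetP/idP => [[u /=]|xs]; first by rewrite inE => us ->.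
  by exists [` fsubsetP sS x xs]%fset; rewrite ?inE.
have tcard : #|t| = #|` s|.
  by rewrite -ts card_imfset /=; [rewrite -cardE | exact: val_inj].
have tphi : im _ (phi \o @fsval _ S) t = [fset phi x | x in s]%fset.
  rewrite -ts; apply/fsetP => w; apply/imfsetP/imfsetP => [[x /= xB ->]|[_ /imfsetP[x /= xB ->] ->]].
    by exists (fsval x) => //; apply/imfsetP; exists x.
  by exists x.
have := g0 t; rewrite /g tcard scard => /eqP; rewrite mulrI_eq0; last exact/lregX/lregN/lreg1.
by rewrite ts tphi; case: (f s <= r); case: (f' _ <= r).
Qed.

Lemma value_distortion (V : seq R) :
  (forall s : {fset W}, (s `<=` S)%fset -> (0 < #|` s| <= m.+1)%N -> f s \in V) ->
  (forall s : {fset W'}, (s `<=` [fset phi x | x in S])%fset ->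
     (0 < #|` s| <= m.+1)%N -> f' s \in V) ->
  forall s : {fset W}, (s `<=` S)%fset -> (0 < #|` s| <= m.+1)%N ->
  `|f s - f' [fset phi x | x in s]%fset| <= (2 * size V + 1)%:R * e.
Proof.
move=> fV f'V s sS scard; rewrite leNgt; apply/negP.
have transfer r : (forall v, v \in V -> gap r e v) ->
    (f s <= r) = (f' [fset phi x | x in s]%fset <= r).
  by move=> gV; apply: sublevel_transfer => // t *; apply: gV; [exact: fV | exact: f'V].
rewrite lter_normr => /orP[far|far].
  have [|r [ar rb gV]] := exists_gap V (f' [fset phi x | x in s]%fset) (f s) e e_gt0.
    by lra.
  by have := transfer r gV; rewrite ar leNgt rb.
have [|r [ar rb gV]] := exists_gap V (f s) (f' [fset phi x | x in s]%fset) e e_gt0.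
  by lra.
by have := transfer r gV; rewrite ar leNgt rb.
Qed.

End Comparison.

(** * Gromov--Hausdorff distance *)

(* Points of T and U are joined by detours through C of extra length rho; as
   rho > 0, this is a metric on the disjoint union without any quotient. *)
Section Gluing.
Context {R : realType} (T U : metricType R) (C : T -> U -> Prop) (rho : R).
Context (rho_gt0 : 0 < rho) (C0 : exists a b, C a b).
Context (Cdis : forall a a' b b', C a b -> C a' b' ->
  `|mdist a a' - mdist b b'| <= 2 * rho).

Let detours x y : set R := [set v | exists a b, C a b /\ v = mdist x a + mdist b y].

Let cross x y : R := inf (detours x y).

Let cross_le x y a b : C a b -> cross x y <= mdist x a + mdist b y.
Proof.
move=> Cab; apply: ge_inf; last by exists a, b.
by exists 0 => _ [a' [b' [_ ->]]]; rewrite addr_ge0 ?mdist_ge0.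
Qed.

Let le_cross x y v : (forall a b, C a b -> v <= mdist x a + mdist b y) -> v <= cross x y.
Proof.
move=> vC; apply: lb_le_inf; last by move=> _ [a [b [Cab ->]]]; exact: vC.
by have [a [b Cab]] := C0; exists (mdist x a + mdist b y), a, b.
Qed.

Let cross_ge0 x y : 0 <= cross x y.
Proof. by apply: le_cross => a b _; rewrite addr_ge0 ?mdist_ge0. Qed.

Let cross_triangle x x' y y' : cross x y <= mdist x x' + cross x' y' + mdist y' y.
Proof.
rewrite -lerBlDr -lerBlDl; apply: le_cross => a b /(cross_le x y).
have := metric_triangle x x' a; have := metric_triangle b y' y; lra.
Qed.

Let cross_crossl x x' y : mdist x x' <= 2 * rho + cross x y + cross x' y.
Proof.
rewrite -lerBlDr -lerBlDl; apply: le_cross => a b Cab.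
rewrite lerBlDl lerBlDr -lerBlDl; apply: le_cross => a' b' Ca'b'.
have := Cdis _ _ _ _ Cab Ca'b'; rewrite ler_norml => /andP[_].
have := metric_triangle b y b'; rewrite (metric_sym y b').
have := metric_triangle x a x'; have := metric_triangle a a' x'.
by rewrite (metric_sym a' x'); lra.
Qed.

Let cross_crossr x y y' : mdist y y' <= 2 * rho + cross x y + cross x y'.
Proof.
rewrite -lerBlDr -lerBlDl; apply: le_cross => a b Cab.
rewrite lerBlDl lerBlDr -lerBlDl; apply: le_cross => a' b' Ca'b'.
have := Cdis _ _ _ _ Cab Ca'b'; rewrite ler_norml => /andP[+ _].
have := metric_triangle a x a'; rewrite (metric_sym a x).
have := metric_triangle y b y'; have := metric_triangle b b' y'.
by rewrite (metric_sym y b); lra.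
Qed.

Let glued_dist (u v : T + U) : R :=
  match u, v with
  | inl x, inl x' => mdist x x'
  | inr y, inr y' => mdist y y'
  | inl x, inr y | inr y, inl x => rho + cross x y
  end.

Let glued_distxx u : glued_dist u u = 0.
Proof. by case: u => x /=; exact: mdistxx. Qed.

Let glued_dist_eq0 u v : glued_dist u v = 0 -> u = v.
Proof.
case: u v => [x|y] [x'|y'] /=; try by move=> /mdist_positivity ->.
  by move=> d0; have := ltr_pwDl rho_gt0 (cross_ge0 x y'); rewrite d0 ltxx.
by move=> d0; have := ltr_pwDl rho_gt0 (cross_ge0 x' y); rewrite d0 ltxx.
Qed.

Let glued_dist_sym u v : glued_dist u v = glued_dist v u.
Proof. by case: u v => [x|y] [x'|y'] //=; exact: metric_sym. Qed.

Let glued_dist_triangle v u w : glued_dist u w <= glued_dist u v + glued_dist v w.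
Proof.
case: u v w => [x|y] [x'|y'] [x''|y''] /=; try exact: metric_triangle.
- by have := cross_triangle x x' y'' y''; rewrite mdistxx; lra.
- by have := cross_crossl x x'' y'; lra.
- by have := cross_triangle x x y'' y'; rewrite mdistxx; lra.
- by have := cross_triangle x'' x' y y; rewrite mdistxx (metric_sym x''); lra.
- by have := cross_crossr x' y y''; lra.
- by have := cross_triangle x'' x'' y y'; rewrite mdistxx (metric_sym y); lra.
Qed.

Lemma exists_gluing : exists (M : metricType R) (f : T -> M) (g : U -> M),
  [/\ forall x x', mdist (f x) (f x') = mdist x x',
      forall y y', mdist (g y) (g y') = mdist y y' &
      forall a b, C a b -> mdist (f a) (g b) <= rho].
Proof.
pose M : metricType R := HB.pack (T + U)%type (isMetric.Build R (T + U)%type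
  glued_distxx glued_dist_eq0 glued_dist_sym glued_dist_triangle).
exists M, inl, inr; split=> // a b Cab.
by have := cross_le a b a b Cab; rewrite !mdistxx /mdist /=; lra.
Qed.

End Gluing.

Section Correspondences.
Context {R : realType}.

Definition correspondence {T U : metricType R} (A : set T) (B : set U)
    (C : T -> U -> Prop) (dis : R) : Prop :=
  [/\ forall a, A a -> exists2 b, B b & C a b,
      forall b, B b -> exists2 a, A a & C a b &
      forall a a' b b', C a b -> C a' b' -> `|mdist a a' - mdist b b'| <= dis].

Lemma dGH_le_correspondence (T U : metricType R) (A : set T) (B : set U) C rho :
  0 < rho -> correspondence A B C (2 * rho) -> (dGH A B <= rho%:E)%E.
Proof.
move=> rho0 [AC BC disC].
have [M [f [g [fA gB fg]]]] : exists (M : metricType R) (f : T -> M) (g : U -> M),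
    [/\ isometric_on A f, isometric_on B g &
        forall a b, C a b -> mdist (f a) (g b) <= rho].
  have [C0|C0] := pselect (exists a b, C a b).
    have [M [f [g [fT gU fg]]]] := exists_gluing T U C rho rho0 C0 disC.
    by exists M, f, g; split.
  have A0 a : ~ A a by move=> /AC[b _ Cab]; apply: C0; exists a, b.
  have B0 b : ~ B b by move=> /BC[a _ Cab]; apply: C0; exists a, b.
  have C0' a b : C a b -> False by move=> Cab; apply: C0; exists a, b.
  have [[t]|T0] := pselect (inhabited T).
    exists T, id, (fun=> t); split; [by move=> x y /A0 | by move=> x y /B0 | by move=> a b /C0'].
  exists U, (fun t => False_rect _ (T0 (inhabits t))), id.
  by split; [move=> x y /A0 | move=> x y /B0 | move=> a b /C0'].
apply: (@le_trans _ _ (hausdorff_dist (f @` A) (g @` B))).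
  by apply: ereal_inf_lbound; exists M, f, g.
apply: ereal_inf_lbound; exists rho => //; split; first exact: ltW.
  by move=> _ [a /AC[b Bb Cab] <-]; exists (g b); [exists b | exact: fg].
by move=> _ [b /BC[a Aa Cab] <-]; exists (f a); [exists a | exact: fg].
Qed.

Lemma correspondence_of_dGH_lt (T U : metricType R) (A : set T) (B : set U) (d : R) :
  (dGH A B < d%:E)%E -> exists (C : T -> U -> Prop) (r : R),
  [/\ 0 <= r, r < d & correspondence A B C (2 * r)].
Proof.
move=> /ereal_inf_lt[_ [M [f [g [fA gB ->]]]]] /ereal_inf_lt[_ [r [r0 AB BA] <-]].
rewrite lte_fin => rd.
exists (fun a b => [/\ A a, B b & mdist (f a) (g b) <= r]), r; split => //; split.
- by move=> a Aa; have [|_ [b Bb <-] ab] := AB (f a); [exists a | exists b].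
- by move=> b Bb; have [|_ [a Aa <-] ab] := BA (g b); [exists b | exists a].
move=> a a' b b' [Aa Bb ab] [Aa' Bb' ab']; rewrite -(fA a a') // -(gB b b') //.
have := metric_triangle (f a) (g b) (f a'); have := metric_triangle (g b) (g b') (f a').
have := metric_triangle (g b) (f a) (g b'); have := metric_triangle (f a) (f a') (g b').
by rewrite (metric_sym (g b) (f a)) (metric_sym (g b') (f a')) ler_norml => *; lra.
Qed.

Lemma dGH_le_distortion (Z Y : metricType R) (phi : Z -> Y) (X X' : set Z) (delta D : R) :
  0 <= D -> (forall x y, X' x -> X' y -> `|mdist x y - mdist (phi x) (phi y)| <= D) ->
  (dGH X X' < delta%:E)%E -> (dGH (phi @` X') [set: Y] < delta%:E)%E ->
  (dGH X [set: Y] <= (D + 2 * delta)%:E)%E.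
Proof.
move=> D0 phiD /correspondence_of_dGH_lt[C1 [r1 [r10 r1d [XC1 C1X C1dis]]]].
move=> /correspondence_of_dGH_lt[C2 [r2 [r20 r2d [YC2 C2Y C2dis]]]].
apply: (dGH_le_correspondence _ _ _ _ (fun x y => exists x', [/\ X' x', C1 x x' & C2 (phi x') y])).
  by lra.
split.
- move=> x /XC1[x' X'x' C1x]; have [|y _ C2y] := YC2 (phi x'); first by exists x'.
  by exists y => //; exists x'.
- move=> y /C2Y[_ [x' X'x' <-] C2y]; have [x Xx C1x] := C1X x' X'x'.
  by exists x => //; exists x'.
move=> x1 x2 y1 y2 [x1' [X1 C11 C21]] [x2' [X2 C12 C22]].
have := C1dis _ _ _ _ C11 C12; have := C2dis _ _ _ _ C21 C22.
have := phiD _ _ X1 X2; rewrite !ler_norml => /andP[? ?] /andP[? ?] /andP[? ?].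
by apply/andP; split; lra.
Qed.

End Correspondences.

(** * Rips and Cech filtrations *)

Section Filtrations.
Context {R : realType}.

Lemma bigmax_attained (I : eqType) (s : seq I) (F : I -> R) :
  \big[Num.max/0]_(x <- s) F x = 0 \/
  exists2 x, x \in s & \big[Num.max/0]_(x <- s) F x = F x.
Proof.
elim: s => [|x s IHs]; first by left; rewrite big_nil.
rewrite big_cons; case: (leP (F x)) => _; last by right; exists x; rewrite ?mem_head.
by case: IHs => [->|[y ys ->]]; [left | right; exists y; rewrite // inE ys orbT].
Qed.

Lemma rips_attained (W : metricType R) (s : {fset W}) : s != fset0 ->
  exists x y, [/\ x \in s, y \in s & rips s = mdist x y].
Proof.
case/fset0Pn => z zs; rewrite /rips.
have [->|[x xs ->]] := bigmax_attained _ s (fun x => \big[Num.max/0]_(y <- s) mdist x y).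
  by exists z, z; rewrite mdistxx.
have [->|[y ys ->]] := bigmax_attained _ s (mdist x); last by exists x, y.
by exists z, z; rewrite mdistxx.
Qed.

Lemma mdist_le_rips (W : metricType R) (s : {fset W}) x y : x \in s -> y \in s ->
  mdist x y <= rips s.
Proof.
move=> xs ys; apply: (@le_trans _ _ (\big[Num.max/0]_(b <- s) mdist x b)).
  exact: le_bigmax_seq.
exact: (le_bigmax_seq _ _ _ (fun a => \big[Num.max/0]_(b <- s) mdist a b)).
Qed.

Lemma rips_edge (W : metricType R) (x y : W) : rips [fset x; y]%fset = mdist x y.
Proof.
apply/le_anti/andP; split; last by apply: mdist_le_rips; rewrite !inE eqxx ?orbT.
have [|a [b [+ + ->]]] := rips_attained _ [fset x; y]%fset.
  by apply/fset0Pn; exists x; rewrite !inE eqxx.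
by rewrite !inE => /orP[] /eqP -> /orP[] /eqP ->; rewrite ?mdistxx ?mdist_ge0 // metric_sym.
Qed.

Lemma rips_monotone (W : metricType R) : fmonotone (@rips R W).
Proof.
move=> s t s0 /fsubsetP st; have [x [y [xs ys ->]]] := rips_attained _ s s0.
by apply: mdist_le_rips; exact: st.
Qed.

Lemma cech_monotone (W E : metricType R) (incl : W -> E) : fmonotone (cech incl).
Proof.
move=> s t /fset0Pn[x _] /fsubsetP st; rewrite /cech ler_pM2l //.
apply: lb_le_inf; first by exists (\big[Num.max/0]_(y <- t) mdist (incl x) (incl y)), (incl x).
move=> _ [c _ <-]; apply: (@le_trans _ _ (\big[Num.max/0]_(y <- s) mdist c (incl y))).
  apply: ge_inf; last by exists c.
  by exists 0 => _ [d _ <-]; exact: bigmax_ge_id.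
exact: sub_bigmax_seq.
Qed.

Lemma filtration_monotone lam (W E : metricType R) (incl : W -> E) :
  fmonotone (filtration lam incl).
Proof. by case: lam; [exact: rips_monotone | exact: cech_monotone]. Qed.

Lemma rips_mem_distances (W : metricType R) (S s : {fset W}) m : (s `<=` S)%fset ->
  (0 < #|` s| <= m.+1)%N -> rips s \in [seq mdist x y | x <- S, y <- S].
Proof.
move=> /fsubsetP sS /andP[]; rewrite cardfs_gt0 => s0 _.
have [x [y [xs ys ->]]] := rips_attained _ s s0.
by apply: allpairs_f; exact: sS.
Qed.

Lemma mem_fvalues (W : choiceType) (f : {fset W} -> R) m (S s : {fset W}) :
  (s `<=` S)%fset -> (0 < #|` s| <= m.+1)%N ->
  f s \in [seq fvalue f t | t <- enum (skeleton m S)].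
Proof.
move=> sS scard; pose t : {set S} := [set x | fsval x \in s]%SET.
have ts : [fset fsval x | x in t]%fset = s.
  apply/fsetP => x; apply/imfsetP/idP => [[u /=]|xs]; first by rewrite inE => us ->.
  by exists [` fsubsetP sS x xs]%fset; rewrite ?inE.
rewrite -ts; apply/mapP; exists t => //; rewrite mem_enum inE.
suff -> : #|t| = #|` s| by [].
by rewrite -ts card_imfset /=; [rewrite -cardE | exact: val_inj].
Qed.

Lemma card_skeleton (W : choiceType) m k (S : {fset W}) : (#|` S| <= k)%N ->
  (#|skeleton m S| <= k + Skm k m)%N.
Proof.
move=> Sk; rewrite -[X in (_ <= X + _)%N]bin1 /Skm -(@big_ltn _ _ addn 1 m.+2 (fun i => 'C(k, i))) //.
rewrite big_add1 big_mkord.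
rewrite -sum1_card (partition_big (fun s : {set S} => inord #|s|.-1 : 'I_m.+1) predT) //=.
apply: leq_sum => i _; rewrite sum1_card; apply: leq_trans (leq_bin2l _ Sk).
rewrite [#|` S|]cardfE -card_draws; apply/subset_leq_card/fintype.subsetP => s.
rewrite inE unfold_in /= inE => /andP[/andP[s0 sm] /eqP <-]; by rewrite inordK prednK.
Qed.

Lemma dB_matching (L1 L2 : nat -> diagram R) (eps e : R) p :
  (dB L1 L2 <= eps%:E)%E -> eps < e -> matching (L1 p) (L2 p) e.
Proof.
move=> L12 epse; have : (bottleneck (L1 p) (L2 p) < e%:E)%E.
  apply: le_lt_trans (_ : (eps%:E < e%:E)%E); last by rewrite lte_fin.
  by apply: le_trans L12; apply: ereal_sup_ubound; exists p.
move=> /ereal_inf_lt[_ [e' [e'0 [M [U1 [U2 [L1E L2E hM hU]]]]] <-]].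
rewrite lte_fin => e'e; exists M, U1, U2; split => // u => [/hM|/hU] /le_trans; apply.
  by rewrite lee_fin ltW.
by rewrite lee_fin ltW.
Qed.

End Filtrations.

Lemma Skm_gt0 k m : (0 < m)%N -> (m < k)%N -> (0 < Skm k m)%N.
Proof. by move=> m0 mk; rewrite /Skm big_ltn // addn_gt0 bin_gt0; lia. Qed.

Section EdgeDistortion.
Context {R : realType} (F : fieldType) (lam : pers_kind) (k m : nat).
Context (hm : (0 < m)%N) (hmk : (m < k)%N).
Context (Z Y : metricType R) (phi : Z -> Y).
Context (EZ EY : metricType R) (inclZ : Z -> EZ) (inclY : Y -> EY).
Context (hcech : lam = CP -> cech_ambient inclZ /\ cech_ambient inclY).
Context (S : {fset Z}) (e : R) (e_gt0 : 0 < e) (Sk : #|` S| = k).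
Context (closeS : forall S' : {fset Z}, (S' `<=` S)%fset ->
   (k - m - 1 <= #|` S'|)%N -> forall p,
   matching (persistence F lam inclZ m S' p)
     (persistence F lam inclY m [fset phi x | x in S']%fset p) e).

Lemma filtration_edgeZ x y : filtration lam inclZ [fset x; y]%fset = mdist x y.
Proof.
case: lam hcech => [_|/(_ erefl)[[_ +] _]]; first exact: rips_edge.
exact.
Qed.

Lemma filtration_edgeY x y : filtration lam inclY [fset x; y]%fset = mdist x y.
Proof.
case: lam hcech => [_|/(_ erefl)[_ [_ +]]]; first exact: rips_edge.
exact.
Qed.

Lemma edge_distortion (V : seq R) (x y : Z) : x \in S -> y \in S ->
  (forall s : {fset Z}, (s `<=` S)%fset -> (0 < #|` s| <= m.+1)%N ->
     filtration lam inclZ s \in V) ->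
  (forall s : {fset Y}, (s `<=` [fset phi x | x in S])%fset ->
     (0 < #|` s| <= m.+1)%N -> filtration lam inclY s \in V) ->
  `|mdist x y - mdist (phi x) (phi y)| <= (2 * size V + 1)%:R * e.
Proof.
move=> xS yS ZV YV; rewrite -filtration_edgeZ -filtration_edgeY -imfset_fset2.
apply: (value_distortion F _ _ _ _ _ m S) => //; try exact: filtration_monotone.
- by rewrite Sk.
- by rewrite Sk.
- by apply/fsubsetP => z; rewrite !inE => /orP[] /eqP ->.
rewrite cardfs2; case: (x != y) => /=; lia.
Qed.

Lemma edge_distortion_rips (x y : Z) : lam = RP -> x \in S -> y \in S ->
  `|mdist x y - mdist (phi x) (phi y)| <= (112 * k ^ 2)%N%:R * e.
Proof.
move=> lamE xS yS; set X := [fset phi x | x in S]%fset.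
pose V := [seq mdist a b | a <- S, b <- S] ++ [seq mdist a b | a <- X, b <- X].
have VV : (2 * size V + 1 <= 112 * k ^ 2)%N.
  rewrite /V size_cat !size_allpairs -/(#|` S|) -/(#|` X|) Sk.
  have Xk : (#|` X| <= k)%N by rewrite -Sk; exact: leq_imfset_card.
  have := leq_mul Xk Xk; have : (0 < k * k)%N by rewrite muln_gt0 (leq_trans _ hmk).
  by rewrite -mulnn; move: (k * k)%N (#|` X| * _)%N => a b; lia.
apply: (@le_trans _ _ ((2 * size V + 1)%:R * e)); last first.
  by rewrite ler_pM2r // ler_nat.
apply: edge_distortion => // s sS scard; rewrite mem_cat lamE /=.
  by rewrite (rips_mem_distances _ _ _ m).
by rewrite orbC (rips_mem_distances _ _ _ m).
Qed.

Lemma edge_distortion_cech (x y : Z) : x \in S -> y \in S ->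
  `|mdist x y - mdist (phi x) (phi y)| <= (224 * Skm k m * k ^ m.+1)%N%:R * e.
Proof.
move=> xS yS; set X := [fset phi x | x in S]%fset.
pose V := [seq fvalue (filtration lam inclZ) t | t <- enum (skeleton m S)] ++
  [seq fvalue (filtration lam inclY) t | t <- enum (skeleton m X)].
have VV : (2 * size V + 1 <= 224 * Skm k m * k ^ m.+1)%N.
  rewrite /V size_cat !size_map -!cardE.
  have cS : (#|skeleton m S| <= k + Skm k m)%N by apply: card_skeleton; rewrite Sk.
  have cX : (#|skeleton m X| <= k + Skm k m)%N.
    by apply: card_skeleton; rewrite -Sk; exact: leq_imfset_card.
  have S0 := Skm_gt0 k m hm hmk.
  have kk : (k <= k ^ m.+1)%N by rewrite -[leqLHS]expn1 leq_exp2l; lia.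
  have aS : (k <= Skm k m * k ^ m.+1)%N by rewrite -[leqLHS]mul1n leq_mul.
  have SS : (Skm k m <= Skm k m * k ^ m.+1)%N by rewrite leq_pmulr // expn_gt0; lia.
  rewrite -mulnA; move: #|skeleton m S| #|skeleton m X| (_ ^ _)%N cS cX aS SS S0 {kk}.
  by move=> c d a cS cX; move: (_ * a)%N => u ? ?; lia.
apply: (@le_trans _ _ ((2 * size V + 1)%:R * e)); last first.
  by rewrite ler_pM2r // ler_nat.
apply: edge_distortion => // s sS scard; rewrite mem_cat.
  by rewrite mem_fvalues.
by rewrite orbC mem_fvalues.
Qed.

End EdgeDistortion.

Theorem corollary23 (R : realType) (F : fieldType) (lam : pers_kind) (k m : nat)
  (hm : (0 < m)%N) (hmk : (m < k)%N)
  (Z Y : metricType R) (phi : Z -> Y)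
  (EZ EY : metricType R) (inclZ : Z -> EZ) (inclY : Y -> EY)
  (hcech : lam = CP -> cech_ambient inclZ /\ cech_ambient inclY)
  (X X' : set Z) (delta eps : R) (heps : 0 <= eps)
  (hX : (dGH X X' < delta%:E)%E)
  (hY : (dGH (phi @` X') [set: Y] < delta%:E)%E)
  (Gamma : set {fset Z})
  (hcard : forall S, Gamma S -> (k - m - 1 <= #|` S| <= k)%N)
  (hcover : forall x1 x2, X' x1 -> X' x2 -> x1 <> x2 ->
     exists S, [/\ Gamma S, #|` S| = k, x1 \in S & x2 \in S])
  (hclosure : forall S S' : {fset Z}, Gamma S -> #|` S| = k ->
     (S' `<=` S)%fset -> (k - m - 1 <= #|` S'|)%N -> Gamma S')
  (hdB : forall S, Gamma S ->
     (dB (persistence F lam inclZ m S)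
         (persistence F lam inclY m [fset phi x | x in S]%fset) <= eps%:E)%E) :
  (lam = RP ->
     (dGH X [set: Y] <= ((112 * k ^ 2)%N%:R * eps + 2 * delta)%:E)%E) /\
  (lam = CP ->
     (dGH X [set: Y] <= ((224 * Skm k m * k ^ m.+1)%N%:R * eps + 2 * delta)%:E)%E).
Proof.
  (* your proof *)
Proof.
pose bound : R := if lam is RP then (112 * k ^ 2)%N%:R else (224 * Skm k m * k ^ m.+1)%N%:R.
have dist_le e x1 x2 : eps < e -> X' x1 -> X' x2 ->
    `|mdist x1 x2 - mdist (phi x1) (phi x2)| <= bound * e.
  move=> epse Xx1 Xx2; have e0 := le_lt_trans heps epse.
  have [->|/eqP x12] := eqVneq x1 x2.
    rewrite !mdistxx subrr normr0 mulr_ge0 ?(ltW e0) // /bound.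
    by case: (lam); exact: ler0n.
  have [S [GS Sk x1S x2S]] := hcover x1 x2 Xx1 Xx2 x12.
  have closeS S' : (S' `<=` S)%fset -> (k - m - 1 <= #|` S'|)%N -> forall p,
      matching (persistence F lam inclZ m S' p)
        (persistence F lam inclY m [fset phi x | x in S']%fset p) e.
    by move=> S'S S'k p; apply: dB_matching epse; exact/hdB/(hclosure S S').
  rewrite /bound; case lamE: lam.
    exact: (edge_distortion_rips F lam k m hm hmk Z Y phi EZ EY inclZ inclY hcech S).
  exact: (edge_distortion_cech F lam k m hm hmk Z Y phi EZ EY inclZ inclY hcech S).
suff dGH_bound : (dGH X [set: Y] <= (bound * eps + 2 * delta)%:E)%E.
  by split=> lamE; move: dGH_bound; rewrite /bound lamE.
have bound0 : 0 <= bound by rewrite /bound; case: (lam); exact: ler0n.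
apply/lee_addgt0Pr => eta eta0.
pose e := eps + eta / (bound + 1).
have b1 : 0 < bound + 1 by lra.
have epse : eps < e by rewrite ltrDl divr_gt0.
apply: le_trans (dGH_le_distortion Z Y phi X X' delta (bound * e) _ _ hX hY) _.
- by rewrite mulr_ge0 // (le_trans heps) // ltW.
- by move=> x y; exact: dist_le.
rewrite -EFinD lee_fin addrAC lerD2r /e mulrDr lerD2l mulrCA ler_piMr ?(ltW eta0) //.
by rewrite ler_pdivrMr // mul1r lerDl.
Qed.
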